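(* Let $p$ be a prime, let $G$ be a finite abelian group of $p$-power order, and let $\varphi\colon A\to B$ be an isomorphism between subgroups $A,B$ of $G$. Then the HNN extension $G^*=\langle G,t\mid t^{-1}at=\varphi(a),\ a\in A\rangle$ is residually $p$ if and only if the order of the restriction of $\varphi$ to $H(G,\varphi)$ is a power of $p$.
   Context: A group is residually $p$ if for every non-trivial element there is a homomorphism to a finite $p$-group not killing it. The core $H(G,\varphi)$ is $\bigcap_k H_k$ where $H_0=A\cap B$ and $H_{k+1}=\varphi^{-1}(H_k)\cap H_k\cap\varphi(H_k)$ (with $\varphi^{-1}(H_k)=\{a\in A:\varphi(a)\in H_k\}$); $\varphi$ restricts to an automorphism of $H(G,\varphi)$. *)

(* Defs.v *)
From mathcomp Require Import all_boot all_fingroup all_solvable.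
Set Implicit Arguments. Unset Strict Implicit. Unset Printing Implicit Defensive.
Import GroupScope.
Local Open Scope group_scope.

(* Words for the HNN extension G^* = < G, t | t^-1 a t = phi a, a in A >.
   A letter is either (inl g) for g in G, or (inr true) = t, (inr false) = t^-1. *)
Definition hnn_word (gT : finGroupType) := seq (gT + bool)%type.

(* One elementary rewriting step of the presentation of G^*
   (monoid presentation: multiplication table of G, invertibility of t,
   and the HNN relation t^-1 a t = phi a). *)
Inductive hnn_step (gT : finGroupType) (G A : {set gT}) (phi : gT -> gT)
  : hnn_word gT -> hnn_word gT -> Prop :=
| hnn_mul u v g h : g \in G -> h \in G ->
    hnn_step G A phi (u ++ [:: inl g; inl h] ++ v) (u ++ [:: inl (g * h)] ++ v)
| hnn_one u v :
    hnn_step G A phi (u ++ [:: inl 1] ++ v) (u ++ v)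
| hnn_tinv u v (b : bool) :
    hnn_step G A phi (u ++ [:: inr b; inr (~~ b)] ++ v) (u ++ v)
| hnn_conj u v a : a \in A ->
    hnn_step G A phi (u ++ [:: inr false; inl a; inr true] ++ v)
                     (u ++ [:: inl (phi a)] ++ v).

Inductive hnn_eq (gT : finGroupType) (G A : {set gT}) (phi : gT -> gT)
  : hnn_word gT -> hnn_word gT -> Prop :=
| hnn_eq_refl w : hnn_eq G A phi w w
| hnn_eq_step w1 w2 : hnn_step G A phi w1 w2 -> hnn_eq G A phi w1 w2
| hnn_eq_sym w1 w2 : hnn_eq G A phi w1 w2 -> hnn_eq G A phi w2 w1
| hnn_eq_trans w1 w2 w3 :
    hnn_eq G A phi w1 w2 -> hnn_eq G A phi w2 w3 -> hnn_eq G A phi w1 w3.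

(* A word represents an element of G^* when all its group letters lie in G. *)
Definition hnn_wf (gT : finGroupType) (G : {set gT}) (w : hnn_word gT) : Prop :=
  forall g : gT, (inl g : (gT + bool)%type) \in w -> g \in G.

(* A homomorphism from G^* to P: a map on words which is multiplicative on
   concatenation and constant on the classes of hnn_eq (i.e. a homomorphism
   from the quotient monoid, which is the group G^* ) . *)
Definition hnn_hom (gT : finGroupType) (G A : {set gT}) (phi : gT -> gT)
  (P : finGroupType) (h : hnn_word gT -> P) : Prop :=
  (forall w1 w2, h (w1 ++ w2) = h w1 * h w2) /\
  (forall w1 w2, hnn_eq G A phi w1 w2 -> h w1 = h w2).

Definition hnn_residually_p (p : nat) (gT : finGroupType) (G A : {set gT})
  (phi : gT -> gT) : Prop :=
  forall w : hnn_word gT, hnn_wf G w -> ~ hnn_eq G A phi w [::] ->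
    exists (P : finGroupType) (h : hnn_word gT -> P),
      [/\ p.-group [set: P], hnn_hom G A phi h & h w != 1].

Fixpoint Hchain (gT : finGroupType) (A B : {group gT})
  (phi : {morphism A >-> gT}) (k : nat) : {set gT} :=
  match k with
  | 0 => A :&: B
  | k'.+1 => phi @*^-1 (Hchain B phi k') :&: Hchain B phi k' :&: phi @* (Hchain B phi k')
  end.

Definition in_core (gT : finGroupType) (A B : {group gT})
  (phi : {morphism A >-> gT}) (x : gT) : Prop :=
  forall k, x \in Hchain B phi k.

Definition core_aut_order (gT : finGroupType) (A B : {group gT})
  (phi : {morphism A >-> gT}) (n : nat) : Prop :=
  [/\ 0 < n,
      (forall x, in_core B phi x -> iter n phi x = x) &
      (forall m, 0 < m -> (forall x, in_core B phi x -> iter m phi x = x) -> n <= m)].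

(* Main.v *)
Require Import Defs.
From HB Require Import structures.
From mathcomp Require Import all_boot all_fingroup all_solvable all_algebra.

(** Call a family of characters [chi_i] of [G], [i] in [Z/n], compatible when
    [chi_(i+1) (phi a) = chi_i a] on [A]; such a family defines a homomorphism
    from [G^*] to the wreath product of a cyclic group by [Z/n], with [t]
    acting as the shift.  Since characters extend from subgroups of [G], one
    can walk from any character; the characters reached from [0] in [k] steps
    are exactly those trivial on [L_k], where [L_0 = G] and
    [L_(k+1) = phi (A :&: L_k)], and [L_k] is the core for large [k].  Hence
    every character lies on a closed walk of length [n] as soon as [n] is large
    and [phi^n] is trivial on the core, and [G] embeds in a finite quotient of
    [G^*], which is a [p]-group if [n] is a power of [p].

    If [G^*] is residually [p], a homomorphism [h] to a finite [p]-group does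
    not separate [phi^d] from the identity on the core when [d] is the order
    [n] of [phi] on the core, nor when [d] is some large power of [p]; so it
    does not when [d] is the [p]-part of [n], which is therefore [n] itself.

    Conversely, start from a [p]-quotient [P] in which [G] embeds and read a
    reduced word [g_0 t^e_1 g_1 ... t^e_n g_n] from left to right.  Iterated
    wreath products by [F_p] produce functions [r_i], invariant under right
    multiplication by [G], that vanish at the prefixes of length less than [i]
    and equal [1] at the prefix of length [i]; so the word is not trivial. *)

Set Implicit Arguments.
Unset Strict Implicit.
Unset Printing Implicit Defensive.

Import GroupScope GRing.Theory.

(** * Wreath products as finite groups *)

Section WreathProduct.

Variables (P : finGroupType) (J : finType) (U : finZmodType).

(* [P] acts on the base group by right translation of the first argument. *)
Definition wreath : predArgType := (P * {ffun P * J -> U})%type.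

HB.instance Definition _ := Finite.on wreath.

Definition wreath_mul (v w : wreath) : wreath :=
  (v.1 * w.1, [ffun z => (v.2 z + w.2 ((z.1 * v.1)%g, z.2))%R]).
Definition wreath_one : wreath := (1, 0%R).
Definition wreath_inv (v : wreath) : wreath :=
  (v.1^-1, [ffun z => (- v.2 ((z.1 * v.1^-1)%g, z.2))%R]).

Lemma wreath_mulA : associative wreath_mul.
Proof.
move=> u v w; congr (_, _) => /=; first by rewrite mulgA.
by apply/ffunP=> z; rewrite !ffunE /= addrA mulgA.
Qed.

Lemma wreath_mul1 : left_id wreath_one wreath_mul.
Proof.
case=> q k; congr (_, _) => /=; first by rewrite mul1g.
by apply/ffunP=> -[x j]; rewrite !ffunE /= add0r mulg1.
Qed.

Lemma wreath_mulV : left_inverse wreath_one wreath_inv wreath_mul.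
Proof.
move=> v; congr (_, _) => /=; first by rewrite mulVg.
by apply/ffunP=> z; rewrite !ffunE /= addNr.
Qed.

HB.instance Definition _ :=
  Finite_isGroup.Build wreath wreath_mulA wreath_mul1 wreath_mulV.

Lemma wreath_pgroup p :
  p.-group [set: P] -> p.-nat #|U| -> p.-group [set: wreath].
Proof.
move=> pP pU; rewrite /pgroup cardsT card_prod card_ffun pnatM pnatX pU.
by rewrite -cardsT [p.-nat _]pP.
Qed.

End WreathProduct.

(** * Additive characters and their gluing *)

Section Characters.

Variables (gT : finGroupType) (U : zmodType).
Implicit Types (S T : {group gT}) (chi : gT -> U).

Definition additive_on (S : {set gT}) chi :=
  {in S &, forall x y, chi (x * y) = (chi x + chi y)%R}.

Lemma additive_on1 S chi : additive_on S chi -> chi 1 = 0%R.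
Proof.
by move=> addS; apply: (addrI (chi 1)); rewrite -addS ?group1 // mulg1 addr0.
Qed.

Lemma additive_onX S chi x n :
  additive_on S chi -> x \in S -> chi (x ^+ n) = (chi x *+ n)%R.
Proof.
move=> addS Sx; elim: n => [|n IHn]; first by rewrite (additive_on1 addS).
by rewrite expgS mulrS addS ?groupX ?IHn.
Qed.

Lemma additive_onV S chi x :
  additive_on S chi -> x \in S -> chi x^-1 = (- chi x)%R.
Proof.
move=> addS Sx; apply: (addrI (chi x)).
by rewrite -addS ?groupV // mulgV subrr (additive_on1 addS).
Qed.

Lemma additive_on_sub (S T : {set gT}) chi :
  S \subset T -> additive_on T chi -> additive_on S chi.
Proof. by move=> /subsetP sST addT x y /sST Tx /sST Ty; apply: addT. Qed.

Lemma additive_onD S chi1 chi2 : additive_on S chi1 -> additive_on S chi2 ->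
  additive_on S (fun x => (chi1 x + chi2 x)%R).
Proof. by move=> add1 add2 x y Sx Sy; rewrite add1 ?add2 // addrACA. Qed.

Lemma additive_onN S chi :
  additive_on S chi -> additive_on S (fun x => (- chi x)%R).
Proof. by move=> addS x y Sx Sy; rewrite addS // opprD. Qed.

(** Two factorizations of an element of [S * T] differ by an element of [S :&: T], where the
    characters agree, so [chi1 s + chi2 t] depends only on [s * t]. *)
Lemma additive_glue S T chi1 chi2 :
    S \subset 'C(T) -> additive_on S chi1 -> additive_on T chi2 ->
    {in S :&: T, chi1 =1 chi2} ->
  exists chi, [/\ additive_on (S <*> T) chi, {in S, chi =1 chi1}
                & {in T, chi =1 chi2}].
Proof.
move=> cST add1 add2 eq12.
pose chi x := (chi1 (divgr S T x) + chi2 (remgr S T x))%R.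
have chiE s t : s \in S -> t \in T -> chi (s * t) = (chi1 s + chi2 t)%R.
  move=> Ss Tt; have STst: s * t \in S * T by rewrite mem_mulg.
  rewrite /chi; move: (mem_divgr STst) (mem_remgr STst) (divgr_eq S T (s * t)).
  set s' := divgr _ _ _; set t' := remgr _ _ _ => Ss' Tt' def_st.
  have def_u: s'^-1 * s = t' * t^-1.
    by apply: (mulIg t); rewrite -mulgA def_st mulKg mulgKV.
  have STu: s'^-1 * s \in S :&: T.
    by rewrite inE {2}def_u !groupM ?groupV.
  have := eq12 _ STu; rewrite {2}def_u add1 ?add2 ?groupV //.
  rewrite (additive_onV add1) // (additive_onV add2) // => eq_u.
  by rewrite -[chi1 s](addNKr (chi1 s')) eq_u -addrA subrK.
exists chi; split=> [x y||].
- rewrite cent_joinEl // => /mulsgP[s t Ss Tt ->] /mulsgP[s' t' Ss' Tt' ->].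
  have cts': t * s' = s' * t by apply/esym/(centP (subsetP cST _ Ss')).
  have ->: s * t * (s' * t') = s * s' * (t * t').
    by rewrite -!mulgA (mulgA t) cts' -mulgA.
  rewrite !chiE ?groupM //.
  by rewrite add1 ?add2 // addrACA.
- by move=> s Ss; rewrite -{1}[s]mulg1 chiE // (additive_on1 add2) addr0.
by move=> t Tt; rewrite -{1}[t]mul1g chiE // (additive_on1 add1) add0r.
Qed.

End Characters.

(** * Extending characters of an abelian group of order [N.+1] with values in ['I_N.+1] *)

Section CharacterExtension.

Variables (gT : finGroupType) (N : nat) (G : {group gT}).
Hypotheses (abG : abelian G) (cardG : #|G| = N.+1).
Implicit Types (S T : {group gT}) (chi : gT -> 'I_N.+1).

(** Stands in for the divisibility of Q/Z in the extension of characters. *)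
Lemma ord_divisible m (c : 'I_N.+1) :
  m %| N.+1 -> (c *+ (N.+1 %/ m) = 0)%R -> exists d : 'I_N.+1, (d *+ m = c)%R.
Proof.
move=> dv_m; have m_gt0: 0 < m by case: m dv_m.
rewrite -FinRing.zmodXgE Zp_expg => /(congr1 val) /= /eqP.
rewrite -/(dvdn _ _) -{1}(divnK dv_m) mulnC dvdn_pmul2r; last first.
  by rewrite divn_gt0 // dvdn_leq.
move=> dv_c; exists (inZp (c %/ m)).
rewrite -FinRing.zmodXgE Zp_expg; apply: val_inj => /=.
by rewrite modnMml divnK // modn_small.
Qed.

Lemma additive_cycle x (d : 'I_N.+1) : (d *+ #[x] = 0)%R ->
  exists chi, additive_on <[x]> chi /\ forall i, chi (x ^+ i) = (d *+ i)%R.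
Proof.
move=> d0; have dv_dx: #[d] %| #[x].
  by rewrite order_dvdn FinRing.zmodXgE d0.
exists (eltm dv_dx); split=> [y z xy xz | i]; last by rewrite eltmE FinRing.zmodXgE.
by rewrite (morphM (eltm_morphism dv_dx)).
Qed.

(** With [m] the order of [x] modulo [S], the value [d] at [x] must satisfy [d *+ m = chi (x ^+ m)].
    This is solvable because [x ^+ N.+1 = 1]. *)
Lemma additive_extend1 S x chi :
    S \subset G -> x \in G -> additive_on S chi ->
  exists chi', additive_on (S <*> <[x]>) chi' /\ {in S, chi' =1 chi}.
Proof.
move=> sSG Gx addS.
have nSx: x \in 'N(S) by apply: subsetP Gx; apply: sub_abelian_norm.
pose m := #[coset S x].
have Sxm i: (x ^+ i \in S) = (m %| i).
  rewrite /m order_dvdn -morphX //; apply/idP/eqP => [/coset_id // | ].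
  by apply: coset_idr; rewrite groupX.
have dv_m: m %| N.+1 by rewrite -Sxm -cardG expg_cardG.
have [||d def_d] := @ord_divisible m (chi (x ^+ m)) => //.
  rewrite -(additive_onX _ addS) ?Sxm // -expgM mulnC divnK // -cardG.
  by rewrite expg_cardG // (additive_on1 addS).
have addSX k : chi (x ^+ (k * m)) = (d *+ (k * m))%R.
  by rewrite mulnC expgM (additive_onX _ addS) ?Sxm // -def_d mulrnA.
have [|chi2 [add2 chi2E]] := @additive_cycle x d.
  have dv: m %| #[x] by rewrite -Sxm expg_order.
  by rewrite -(divnK dv) -addSX divnK // expg_order (additive_on1 addS).
have [||chi' [add' chi'S _]] := additive_glue _ addS add2.
- by apply: sub_abelian_cent2 abG _ _; rewrite ?cycle_subG.
- move=> y /setIP[Sy /cycleP[i def_y]]; rewrite def_y in Sy *.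
  by rewrite chi2E; move: Sy; rewrite Sxm => /dvdnP[k ->].
by exists chi'.
Qed.

Lemma additive_extend S chi : S \subset G -> additive_on S chi ->
  exists chi', additive_on G chi' /\ {in S, chi' =1 chi}.
Proof.
have [n] := ubnP (#|G| - #|S|); elim: n => // n IHn in S chi *.
move=> leGSn sSG addS; have [sGS | /subsetPn[x Gx nSx]] := boolP (G \subset S).
  by exists chi; split=> //; apply: additive_on_sub addS.
have [chi1 [add1 chi1S]] := additive_extend1 sSG Gx addS.
have sSxG: S <*> <[x]> \subset G by rewrite join_subG sSG cycle_subG.
have prS: S \proper S <*> <[x]>.
  rewrite properE joing_subl; apply: contra nSx => /subsetP-> //.
  by rewrite mem_gen // inE cycle_id orbT.
have [|chi2 [add2 chi2S]] := IHn [group of S <*> <[x]>] chi1 _ sSxG add1.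
  have lt1 := proper_card prS; have le2 := subset_leq_card sSxG.
  rewrite ltnS in leGSn; apply: leq_trans leGSn; rewrite ltn_sub2l //.
  exact: leq_trans lt1 le2.
exists chi2; split=> // y Sy; rewrite chi2S ?chi1S //.
by apply: (subsetP (joing_subl S <[x]>)).
Qed.

Lemma additive_separate g :
  g \in G -> g != 1 -> exists2 chi : gT -> 'I_N.+1, additive_on G chi & chi g <> 0%R.
Proof.
move=> Gg ntg; have dv_g: #[g] %| N.+1 by rewrite -cardG order_dvdG.
have g_gt1: 1 < #[g] by rewrite order_gt1.
(* An element of order [#[g]], so [g] is not killed. *)
pose d : 'I_N.+1 := inZp (N.+1 %/ #[g]).
have [|chi1 [add1 chi1E]] := @additive_cycle g d.
  rewrite -FinRing.zmodXgE Zp_expg; apply: val_inj => /=.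
  by rewrite modnMml divnK // modnn.
have [|chi [addG chi_g]] := additive_extend _ add1; first by rewrite cycle_subG.
exists chi => //; rewrite chi_g ?cycle_id // -{1}[g]expg1 chi1E mulr1n.
move/(congr1 val) => /=; rewrite modn_small ?ltn_Pdiv // => /eqP.
by rewrite -leqn0 leqNgt divn_gt0 // dvdn_leq.
Qed.

End CharacterExtension.

(** * Iterated images of [G] and the core *)

Section HNN.

Variables (gT : finGroupType) (G A B : {group gT}) (phi : {morphism A >-> gT}).

Definition hnn_rep (P : finGroupType) (f : gT -> P) (t : P) :=
  {in G &, {morph f : x y / x * y}} /\
  {in A, forall a, f a * t = t * f (phi a)}.

Hypotheses (abG : abelian G) (sAG : A \subset G) (sBG : B \subset G).
Hypothesis (isoAB : isom A B phi).

Let injphi : 'injm phi. Proof. by case/isomP: isoAB. Qed.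
Let imphi : phi @* A = B. Proof. by case/isomP: isoAB. Qed.

Lemma mem_isom a : a \in A -> phi a \in B.
Proof. by move=> Aa; rewrite -imphi mem_morphim. Qed.

(** These are the groups [L_k]; [phi @*] itself intersects its argument with [A]. *)
Fixpoint image_chain k : {group gT} :=
  if k is k'.+1 then [group of phi @* image_chain k'] else G.

Lemma image_chainS k : image_chain k.+1 \subset image_chain k.
Proof.
elim: k => [|k IHk]; last exact: morphimS.
by rewrite /= -morphimIdom (setIidPl sAG) imphi.
Qed.

Lemma image_chain_stable n : #|G| <= n -> image_chain n.+1 :=: image_chain n.
Proof.
(* Until the chain stabilizes, each step loses at least one element. *)
have: image_chain n.+1 :=: image_chain n \/ n + #|image_chain n| <= #|G|.
  elim: n => [|n [eqn | len]]; first by right.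
    by left; apply: (congr1 (fun S : {set gT} => phi @* S) eqn).
  have:= image_chainS n; rewrite subEproper => /predU1P[eqn | ltn].
    by left; apply: (congr1 (fun S : {set gT} => phi @* S) eqn).
  right; rewrite addSnnS; apply: leq_trans len.
  by rewrite leq_add2l; apply: proper_card.
case=> // len leGn; have:= leq_trans len leGn.
by rewrite -{3}[n]addn0 leq_add2l leqNgt cardG_gt0.
Qed.

Lemma in_core_dom x : in_core B phi x -> x \in A.
Proof. by move/(_ 0) => /setIP[]. Qed.

Lemma in_core_image x : in_core B phi x -> in_core B phi (phi x).
Proof. by move=> Hx k; have /setIP[/setIP[/morphpreP[]]] := Hx k.+1. Qed.

Lemma in_core_iter x i : in_core B phi x -> in_core B phi (iter i phi x).
Proof. by move=> Hx; elim: i => //= i; apply: in_core_image. Qed.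

Lemma in_core_preimage x :
  in_core B phi x -> exists2 y, in_core B phi y & x = phi y.
Proof.
move=> Hx; have /setIP[_ /morphimP[y Ay _ def_x]] := Hx 1%N.
(* By injectivity, the preimage found at level 1 serves at every level. *)
exists y => // k; have /setIP[_ /morphimP[z Az Hz]] := Hx k.+1.
by rewrite def_x => /(injmP injphi)->.
Qed.

Lemma in_core_chain n x : in_core B phi x -> x \in image_chain n.
Proof.
elim: n x => [|n IHn] x Hx; first by rewrite (subsetP sAG) ?in_core_dom.
have [y Hy ->] := in_core_preimage Hx.
by rewrite mem_morphim ?IHn // in_core_dom.
Qed.

(** The stable term [L] satisfies [phi @* L = L]. Comparing its order with that of [A :&: L] gives
    [L \subset A], so [L] is an invariant subgroup of [A :&: B] and lies in every [H_k]. *)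
Lemma in_coreP n x : #|G| <= n -> reflect (in_core B phi x) (x \in image_chain n).
Proof.
move=> leGn; have fixL := image_chain_stable leGn.
set L := image_chain n in fixL *; have imL: phi @* L = L := fixL.
have sLA: L \subset A.
  apply/setIidPr/eqP; rewrite eqEcard subsetIr -{1}imL -morphimIdom.
  by rewrite card_injm ?subsetIl /=.
apply: (iffP idP) => [Lx k | ].
  elim: k x Lx => [|k IHk] x Lx /=.
    by rewrite inE (subsetP sLA) // -imphi (subsetP (morphimS phi sLA)) ?imL.
  have Ax := subsetP sLA x Lx.
  have Lphix: phi x \in L by rewrite -imL mem_morphim.
  rewrite !inE Ax (IHk _ Lphix) (IHk _ Lx) /=.
  have:= Lx; rewrite -{1}imL => /morphimP[y Ay Ly ->].
  by rewrite mem_morphim ?IHk.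
by move=> Hx; apply: in_core_chain.
Qed.

(** * Walks of characters and an embedding of [G] in a finite quotient *)

Variable N : nat.
Hypothesis cardG : #|G| = N.+1.
Implicit Types (psi : gT -> 'I_N.+1) (chi : nat -> gT -> 'I_N.+1).

Definition walk n chi :=
  (forall i, additive_on G (chi i)) /\
  (forall i, i < n -> {in A, forall a, chi i.+1 (phi a) = chi i a}).

Lemma walk_forward n psi : additive_on G psi ->
  exists2 chi, walk n chi & chi 0 = psi.
Proof.
elim: n psi => [|n IHn] psi addG; first by exists (fun=> psi).
have invG b: b \in B -> invm injphi b \in G.
  by rewrite -imphi => /morphimP[a Aa _ ->]; rewrite /= invmE ?(subsetP sAG).
have [|psi1 [add1 psi1B]] :=
  @additive_extend _ _ _ abG cardG B (psi \o invm injphi) sBG.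
  by move=> x y Bx By /=; rewrite morphM ?imphi //= addG ?invG.
have [chi [chiG chiS] chi0] := IHn psi1 add1.
exists (fun i => if i is i'.+1 then chi i' else psi) => //.
split=> [[] // | [|i] lt_in a Aa]; last exact: chiS.
by rewrite chi0 psi1B ?mem_isom //= invmE.
Qed.

(** The walk is built backwards from [psi]. The character before it must be [psi \o phi] on [A] and
    is chosen to vanish on the previous [L_k]; the two conditions agree because [phi] maps
    [A :&: L_k] into the group where [psi] vanishes. *)
Lemma walk_from0 n psi : additive_on G psi ->
    {in image_chain n, forall x, psi x = 0%R} ->
  exists2 chi, walk n chi & {in G, forall x, chi 0 x = 0%R} /\ chi n = psi.
Proof.
elim: n psi => [|n IHn] psi addG psi0; first by exists (fun=> psi).
have addA: additive_on A (psi \o phi).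
  by move=> x y Ax Ay /=; rewrite morphM // addG // (subsetP sBG) ?mem_isom.
have sLG k: image_chain k \subset G.
  by elim: k => // k; apply: subset_trans; apply: image_chainS.
have [||||psi1 [add1 psi1A psi1L]] :=
  @additive_glue _ _ A (image_chain n) (psi \o phi) (fun=> 0%R) => //.
- exact: sub_abelian_cent2 abG _ _.
- by move=> x y _ _; rewrite addr0.
- by move=> x /setIP[Ax Lx] /=; rewrite psi0 ?mem_morphim.
have [|psi2 [add2 psi2E]] := additive_extend abG cardG _ add1.
  by rewrite join_subG sAG sLG.
have [x Lx | chi [chiG chiS] [chi0 chin]] := IHn psi2 add2.
  by rewrite psi2E ?psi1L // (subsetP (joing_subr A _)).
exists (fun i => if i <= n then chi i else psi); last first.
  by split=> [//|]; rewrite ltnn.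
split=> [i | i lt_in a Aa]; first by case: ifP.
have:= lt_in; rewrite ltnS => ->; have:= lt_in.
rewrite ltnS leq_eqVlt => /predU1P[-> | lt_in']; last by rewrite lt_in' chiS.
by rewrite ltnn chin psi2E ?psi1A // (subsetP (joing_subl A _)).
Qed.

(** A walk [om] from [psi] ends at a character that equals [psi] on the core, since [phi^n] is
    trivial there. A walk from 0 to the difference [psi - om n], added to [om], closes it. *)
Lemma walk_closed n psi :
    #|G| <= n -> (forall x, in_core B phi x -> iter n phi x = x) ->
    additive_on G psi ->
  exists2 chi, walk n chi & {in G, chi 0 =1 psi} /\ {in G, chi n =1 psi}.
Proof.
move=> leGn phin addG; have [om [omG omS] om0] := walk_forward n addG.
have [||de [deG deS] [de0 den]] :=
  @walk_from0 n (fun x => psi x + - om n x)%R.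
- by apply: additive_onD => //; apply: additive_onN.
- move=> x /(in_coreP _ leGn) Hx; apply/eqP; rewrite subr_eq0 -{2}(phin x Hx).
  have: forall i, i <= n -> om i (iter i phi x) = psi x; last by move->.
  elim=> [|i IHi] lt_in; first by rewrite om0.
  by rewrite /= omS ?IHi ?(ltnW lt_in) //; apply/in_core_dom/in_core_iter.
exists (fun i x => om i x + de i x)%R; last first.
  split=> x Gx; first by rewrite om0 de0 ?addr0.
  by rewrite den addrC subrK.
split=> [i | i lt_in a Aa]; first exact: additive_onD.
by rewrite omS ?deS.
Qed.


(** The period [m.+1] need not be a power of [p]: in general the finite quotient still shows that
    [G] embeds in [G^*]. *)
Lemma hnn_rep_faithful m :
    #|G| <= m.+1 -> (forall x, in_core B phi x -> iter m.+1 phi x = x) ->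
  exists (P : finGroupType) (f : gT -> P) (t : P),
    [/\ hnn_rep f t, {in G, forall g, f g = 1 -> g = 1}
      & forall p, p.-nat m.+1 -> p.-group G -> p.-group [set: P]].
Proof.
move=> leGm phim.
have sep g : exists2 chi, walk m.+1 chi
    & {in G, chi m.+1 =1 chi 0} /\ (g \in G -> g != 1 -> chi 0 g <> 0%R).
  have [/andP[Gg ntg] | ] := boolP ((g \in G) && (g != 1)).
    have [psi addG psi_g] := additive_separate abG cardG Gg ntg.
    have [chi wchi [chi0 chim]] := walk_closed leGm phim addG.
    by exists chi => //; split=> [x Gx | _ _]; rewrite ?chim ?chi0.
  (* The zero walk is a default where nothing has to be separated. *)
  rewrite negb_and => ng; exists (fun _ _ => 0%R).
    by split=> [i x y _ _ | //]; rewrite addr0.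
  by split=> // Gg ntg; rewrite Gg ntg in ng.
have [chi wchi closed] := fin_all_exists2 sep.
pose W := wreath 'I_m.+1 gT 'I_N.+1.
pose f y : W := (1, [ffun z : 'I_m.+1 * gT => chi z.2 z.1 y]).
pose t : W := (inZp 1, 0%R).
exists W, f, t; split.
- split=> [x y Gx Gy | a Aa]; congr (_, _); rewrite /= ?mulg1 ?mul1g //.
    by apply/ffunP=> -[i g]; rewrite !ffunE mulg1 (proj1 (wchi g)).
  apply/ffunP=> -[i g]; rewrite !ffunE /= addr0 add0r.
  have [chiG chiS] := wchi g.
  (* At the last index the shift wraps around, which is where closedness is used. *)
  rewrite modnDmr addn1; have:= ltn_ord i; rewrite leq_eqVlt => /predU1P[im | lt_im].
    have Gphia: phi a \in G by rewrite (subsetP sBG) ?mem_isom.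
    by rewrite im modnn -(proj1 (closed g)) // chiS //; case: im => ->.
  by rewrite modn_small // chiS.
- move=> g Gg [] /ffunP/(_ (ord0, g)); rewrite !ffunE /= => chi0g.
  by apply/eqP/idPn => ntg; case: (proj2 (closed g) Gg ntg).
move=> p pm pG; apply: wreath_pgroup; first by rewrite /pgroup cardsT card_ord.
by rewrite card_ord -cardG.
Qed.

(** * Evaluation of words and reduced forms *)

Section Evaluation.

Variables (P : finGroupType) (f : gT -> P) (t : P).

(** The presentation does not constrain letters outside [G]; they are sent to 1. *)
Definition letter_val (x : gT + bool) : P :=
  match x with
  | inl g => if g \in G then f g else 1
  | inr b => if b then t else t^-1
  end.

Definition word_val (w : hnn_word gT) := \prod_(x <- w) letter_val x.

Hypothesis rep : hnn_rep f t.

Lemma hnn_rep1 : f 1 = 1.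
Proof. by apply: (mulgI (f 1)); rewrite -(proj1 rep) // !mulg1. Qed.

Lemma hnn_repV g : g \in G -> f g^-1 = (f g)^-1.
Proof.
move=> Gg; apply: (mulgI (f g)).
by rewrite -(proj1 rep) ?groupV // !mulgV hnn_rep1.
Qed.

Lemma word_val_hom : hnn_hom G A phi word_val.
Proof.
have [fM ft] := rep; split=> [w1 w2 | w1 w2]; first exact: big_cat.
elim=> // {w1 w2}; last by move=> w1 w2 w3 _ -> _ ->.
move=> _ _ [u v g h Gg Gh | u v | u v b | u v a Aa];
  rewrite /word_val !big_cat /= !(big_cons, big_nil) /=.
- by rewrite !mulg1 groupM // !ifT // fM.
- by rewrite group1 hnn_rep1 !mul1g.
- by case: b; rewrite /= mulg1 ?mulgV ?mulVg mul1g.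
rewrite !mulg1 !ifT ?(subsetP sBG _ (mem_isom _)) ?(subsetP sAG) //.
by rewrite ft // mulKg.
Qed.

End Evaluation.

Lemma hnn_eq_context u v w1 w2 : hnn_eq G A phi w1 w2 ->
  hnn_eq G A phi (u ++ w1 ++ v) (u ++ w2 ++ v).
Proof.
elim=> {w1 w2} [w | w1 w2 step | w1 w2 _ | w1 w2 w3 _ IH1 _ IH2].
- exact: hnn_eq_refl.
- apply: hnn_eq_step; case: step => [u' v' g h Gg Gh | u' v' | u' v' b | u' v' a Aa].
  + by rewrite -!catA !(catA u u'); apply: (hnn_mul (G := G)).
  + by rewrite -!catA !(catA u u'); apply: hnn_one.
  + by rewrite -!catA !(catA u u'); apply: hnn_tinv.
  by rewrite -!catA !(catA u u'); apply: hnn_conj.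
- exact: hnn_eq_sym.
exact: hnn_eq_trans IH1 IH2.
Qed.

(* A pair [(b, g)] stands for [t g] if [b] and for [t^-1 g] otherwise. *)
Definition nf_word g (l : seq (bool * gT)) : hnn_word gT :=
  inl g :: flatten [seq [:: inr u.1; inl u.2] | u <- l].

(** Britton's condition: no [t^-1 a t] with [a] in [A] and no [t b t^-1] with [b] in [B]. *)
Definition unpinched (u v : bool * gT) :=
  (v.1 != u.1) ==> (u.2 \notin (if u.1 then B else A)).

Lemma pinch b g : g \in (if b then B else A) ->
  exists2 g', g' \in G & hnn_eq G A phi [:: inr b; inl g; inr (~~ b)] [:: inl g'].
Proof.
case: b => [|Ag]; last first.
  exists (phi g); first by rewrite (subsetP sBG) ?mem_isom.
  exact: hnn_eq_step (hnn_conj _ _ [::] [::] Ag).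
rewrite -imphi => /morphimP[a Aa _ ->]; exists a; first exact: subsetP Aa.
apply: (@hnn_eq_trans _ _ _ _ _ [:: inr true; inr false; inl a; inr true; inr false]).
  exact/hnn_eq_sym/hnn_eq_step/(hnn_conj _ _ [:: inr true] [:: inr false] Aa).
apply: (@hnn_eq_trans _ _ _ _ _ [:: inl a; inr true; inr false]).
  exact/hnn_eq_step/(hnn_tinv _ _ _ [::] [:: inl a; inr true; inr false] true).
exact/hnn_eq_step/(hnn_tinv _ _ _ [:: inl a] [::] true).
Qed.

(** Letters are added on the left of a reduced word, so a pinch can only occur at the front;
    removing it leaves a shorter reduced word. *)
Lemma reduced_form w : hnn_wf G w ->
  exists g l, [/\ g \in G, all (fun u => u.2 \in G) l, sorted unpinched l
                & hnn_eq G A phi w (nf_word g l)].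
Proof.
elim: w => [|x w IHw] wf.
  exists 1, [::]; split=> //.
  exact/hnn_eq_sym/hnn_eq_step/(hnn_one _ _ _ [::] [::]).
have [|g [l [Gg Gl red eqw]]] := IHw.
  by move=> k wk; apply: wf; rewrite inE wk orbT.
have := hnn_eq_context [:: x] [::] eqw; rewrite !cats0 /= => eqxw.
case: x => [k | b] in wf eqxw *.
  have Gk: k \in G by apply: wf; rewrite inE eqxx.
  exists (k * g), l; split; rewrite ?groupM //.
  apply: hnn_eq_trans eqxw _.
  exact: hnn_eq_step (hnn_mul _ _ [::] (behead (nf_word g l)) Gk Gg).
have [red' | ] := boolP (sorted unpinched ((b, g) :: l)).
  exists 1, ((b, g) :: l); split=> //; first by rewrite /= Gg.
  apply: hnn_eq_trans eqxw _.
  exact/hnn_eq_sym/hnn_eq_step/(hnn_one _ _ _ [::]).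
case: l => [|[c k] l] // in Gl red eqw eqxw *.
rewrite /= [path _ _ _]red andbT negb_imply negbK /= => /andP[neq_cb Dg].
have def_c: c = ~~ b by move: neq_cb; case: (b); case: (c).
have [g' Gg' pin] := pinch Dg; have /= /andP[Gk Gl'] := Gl.
exists (g' * k), l; split; rewrite ?groupM //; first exact: path_sorted red.
apply: hnn_eq_trans eqxw _; rewrite def_c.
apply: hnn_eq_trans (hnn_eq_context [::] (nf_word k l) pin) _.
exact: hnn_eq_step (hnn_mul _ _ [::] (behead (nf_word k l)) Gg' Gk).
Qed.

(** * Separating reduced words from the identity *)

Section NormalFormValue.

Variables (P : finGroupType) (f : gT -> P) (t : P).

Definition nf_val g (l : seq (bool * gT)) : P :=
  f g * \prod_(u <- l) ((if u.1 then t else t^-1) * f u.2).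

Lemma nf_val_rcons g l u :
  nf_val g (rcons l u) = nf_val g l * (if u.1 then t else t^-1) * f u.2.
Proof. by rewrite /nf_val big_rcons /= !mulgA. Qed.

Lemma word_val_nf g l : g \in G -> all (fun u => u.2 \in G) l ->
  word_val f t (nf_word g l) = nf_val g l.
Proof.
move=> Gg Gl; rewrite /word_val big_cons /= Gg; congr (_ * _).
elim: l Gl => [|u l IHl] /=; first by rewrite !big_nil.
by case/andP=> Gu Gl; rewrite !big_cons /= Gu IHl // mulgA.
Qed.

End NormalFormValue.

(** Induction on the last letter. Sending [t] to [(t', k)] in a wreath product over [Q] makes the
    base coordinate at 1 accumulate values of [k], up to sign, along the word. The projection [pi]
    to [P], where [f] is injective on [G], serves to test cosets of [A]. *)
Lemma reduced_nf_val p (P : finGroupType) (f : gT -> P) (t : P) g0 l :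
    prime p -> p.-group [set: P] -> hnn_rep f t ->
    {in G, forall g, f g = 1 -> g = 1} ->
    g0 \in G -> all (fun u => u.2 \in G) l -> sorted unpinched l ->
  exists (Q : finGroupType) (f' : gT -> Q) (t' : Q) (pi : Q -> P) (r : Q -> 'F_p),
  [/\ p.-group [set: Q], hnn_rep f' t',
      [/\ {morph pi : x y / x * y}, {in G, forall g, pi (f' g) = f g} & pi t' = t],
      {in G, forall g x, r (x * f' g) = r x}
    & (forall j, j < size l -> r (nf_val f' t' g0 (take j l)) = 0%R)
      /\ r (nf_val f' t' g0 l) = 1%R].
Proof.
move=> p_pr pP [fM ft] f_inj Gg0.
have injf x y: x \in G -> y \in G -> f x = f y -> x = y.
  move=> Gx Gy eq_xy; apply: (mulIg y^-1); rewrite mulgV.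
  apply: f_inj; first by rewrite groupM ?groupV.
  by rewrite fM ?groupV // (hnn_repV (conj fM ft)) // eq_xy mulgV.
have AG := subsetP sAG.
elim/last_ind: l => [|l [e g] IHl] Gl red.
  by exists P, f, t, id, (fun=> 1%R).
have [Gg Gl']: g \in G /\ all (fun u => u.2 \in G) l.
  by move: Gl; rewrite all_rcons /= => /andP.
have red': sorted unpinched l.
  by case: (l) red => [//|u l'] /=; rewrite rcons_path => /andP[].
have [Q [f' [t' [pi [r [pQ rep' [piM pif pit] rG [r0 r1]]]]]]] := IHl Gl' red'.
have [f'M f't] := rep'.
have pi1: pi 1 = 1 by apply: (mulgI (pi 1)); rewrite -piM !mulg1.
have piV: pi t'^-1 = t^-1.
  by apply: (mulgI t); rewrite mulgV -pit -piM mulgV.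
have pi_nf h s: h \in G -> all (fun u => u.2 \in G) s ->
  pi (nf_val f' t' h s) = nf_val f t h s.
  move=> Gh; elim/last_ind: s => [_|s u IHs].
    by rewrite /nf_val !big_nil !mulg1 pif.
  rewrite all_rcons => /andP[Gu Gs]; rewrite !nf_val_rcons piM piM IHs // pif //.
  by case: ifP; rewrite ?pit ?piV.
pose z := nf_val f t g0 l * (if e then 1 else t^-1).
(* [z] represents the coset of [A] at which the last letter [t^(+-1)] acts. *)
pose inc x := z^-1 * pi x \in f @: A.
(* The two cases make [R] grow by [r] of the prefix whether that letter is
   [t] or [t^-1]; only a pinch could make an earlier letter contribute. *)
pose k x : 'F_p :=
  (if inc x then if e then r x else - r (x * t')%g else 0)%R.
have incA x a: a \in A -> inc (x * f' a) = inc x.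
  move=> Aa; rewrite /inc piM pif ?AG // mulgA.
  apply/imsetP/imsetP=> -[b Ab def_b].
    exists (b * a^-1); rewrite ?groupM ?groupV //.
    rewrite fM ?groupV ?AG // (hnn_repV (conj fM ft)) ?AG //.
    by rewrite -def_b mulgK.
  by exists (b * a); rewrite ?groupM // def_b fM ?AG.
(* This is what the relation [F a * T = T * F (phi a)] amounts to on the base group. *)
have kA x a: a \in A -> k (x * f' a) = k x.
  move=> Aa; rewrite /k incA // rG ?AG //.
  by rewrite -mulgA f't // mulgA rG // (subsetP sBG) ?mem_isom.
pose W := wreath Q unit 'F_p.
pose F h : W := (f' h, 0%R); pose T : W := (t', [ffun x => k x.1]).
pose R (w : W) : 'F_p := w.2 (1, tt).
have FM: {in G &, {morph F : x y / x * y}}.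
  move=> x y Gx Gy; congr (_, _) => /=; first exact: f'M.
  by apply/ffunP=> u; rewrite !ffunE addr0.
have RF w h: R (w * F h) = R w by rewrite /R !ffunE addr0.
have RT w: R (w * T) = (R w + k w.1)%R by rewrite /R !ffunE /= mul1g.
have RTV w: R (w * T^-1) = (R w - k (w.1 * t'^-1)%g)%R.
  by rewrite -{2}[w](mulgKV T) RT addrK.
have fst_nf h s: (nf_val F T h s).1 = nf_val f' t' h s.
  elim/last_ind: s => [|s u IHs]; first by rewrite /nf_val !big_nil.
  by rewrite !nf_val_rcons -IHs /=; case: ifP.
exists W, F, T, (fun w => pi w.1), R; split.
- by apply: wreath_pgroup; rewrite ?card_Fp ?pnat_id.
- split=> // a Aa; congr (_, _) => /=; first exact: f't.
  by apply/ffunP=> -[x u]; rewrite !ffunE /= add0r addr0 kA.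
- by split=> [v w | h Gh |] //=; rewrite ?piM ?pif.
- by move=> h Gh w; apply: RF.
(* Here [j = size l] is included, although [r] is 1 at that prefix. *)
have R0 j: j <= size l -> R (nf_val F T g0 (take j l)) = 0%R.
  elim: j => [_ | j IHj lt_jl].
    by rewrite take0 /nf_val big_nil mulg1 /R ffunE.
  pose u := nth (true, 1) l j; pose y := nf_val f' t' g0 (take j l).
  have takeS: take j.+1 l = rcons (take j l) u by apply: take_nth.
  have Gu: u.2 \in G by apply: (all_nthP (true, 1) Gl').
  have Gtake: all (fun u => u.2 \in G) (take j l).
    by move: Gl'; rewrite -{1}(cat_take_drop j l) all_cat => /andP[].
  have ry: r y = 0%R by apply: r0.
  have ryS: j.+1 < size l -> r (y * (if u.1 then t' else t'^-1)) = 0%R.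
    by move/r0; rewrite takeS nf_val_rcons rG.
  have pi_y: pi y = nf_val f t g0 (take j l) by apply: pi_nf.
  have zE: j.+1 = size l ->
      z = pi y * (if u.1 then t else t^-1) * f u.2 * (if e then 1 else t^-1).
    by move=> def_j; rewrite /z -{1}(take_size l) -def_j takeS nf_val_rcons pi_y.
  have red_u: j.+1 = size l -> unpinched u (e, g).
    move=> def_j; move: red; rewrite -{1}(take_size l) -def_j takeS.
    case: (take j l) => [|x s] /=; first by rewrite andbT.
    by rewrite rcons_path last_rcons => /andP[].
  (* If [u] has the sign of the last letter, the increment is 0 or, up to sign, [r y = 0]. Otherwise
     it involves [r] at the next prefix, which vanishes unless that prefix is all of [l]; then [inc]
     would make [u.2] a pinch. *)
  rewrite takeS nf_val_rcons RF; case def_u: u.1 in ryS zE red_u *.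
    rewrite RT IHj ?(ltnW lt_jl) // add0r fst_nf -/y /k.
    case: ifP => // inc_y; case def_e: e => //.
    move: (lt_jl); rewrite leq_eqVlt => /predU1P[eq_j | /ryS->]; last exact: oppr0.
    have:= red_u eq_j; rewrite /unpinched def_u def_e /= => /negP[].
    have:= inc_y; rewrite /inc zE // def_e !invMg invgK -!mulgA mulVg mulg1.
    case/imsetP=> a Aa def_a; have Aa' := groupVr Aa.
    rewrite (injf u.2 (phi a^-1)) ?mem_isom ?(subsetP sBG _ (mem_isom _)) //.
    apply: (mulgI t); rewrite -ft // (hnn_repV (conj fM ft)) ?AG // -def_a.
    by rewrite !invMg !invgK -!mulgA mulVg mulg1.
  rewrite RTV IHj ?(ltnW lt_jl) // sub0r fst_nf -/y /k.
  case: ifP => [inc_y | _]; last exact: oppr0.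
  case def_e: e; last by rewrite mulgKV ry !oppr0.
  move: (lt_jl); rewrite leq_eqVlt => /predU1P[eq_j | /ryS->]; last exact: oppr0.
  have:= red_u eq_j; rewrite /unpinched def_u def_e /= => /negP[].
  have:= inc_y; rewrite /inc zE // def_e piM piV mulg1 !invMg -mulgA.
  rewrite -invMg mulVg mulg1 => /imsetP[a Aa def_a].
  have <-: a^-1 = u.2; last by rewrite groupV.
  apply: injf => //; first by rewrite groupV AG.
  by rewrite (hnn_repV (conj fM ft)) ?AG // -def_a invgK.
split=> [j|].
  by rewrite size_rcons ltnS => le_jl; rewrite -cats1 takel_cat ?R0.
have inc_z x: pi x = z -> inc x.
  move=> def_x; rewrite /inc def_x mulVg; apply/imsetP; exists 1 => //.
  by rewrite (hnn_rep1 (conj fM ft)).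
have pi_l := pi_nf _ _ Gg0 Gl'.
have Rl: R (nf_val F T g0 l) = 0%R by rewrite -{1}(take_size l) R0.
rewrite nf_val_rcons RF /=; case def_e: e.
  rewrite RT Rl add0r fst_nf /k inc_z ?def_e ?r1 //.
  by rewrite /z def_e mulg1.
rewrite RTV Rl sub0r fst_nf /k inc_z ?def_e; last by rewrite piM piV /z def_e pi_l.
by rewrite mulgKV r1 opprK.
Qed.

(** * From a [p]-power period to residual [p]-finiteness *)

Lemma residually_p_of_period p e : prime p -> p.-group G ->
    (forall x, in_core B phi x -> iter (p ^ e) phi x = x) ->
  hnn_residually_p p G A phi.
Proof.
move=> p_pr pG phie w wf ntw; have p_gt1 := prime_gt1 p_pr.
(* Still a period and a power of [p], but now at least [#|G|], so that [L_n] is the core. *)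
pose n := (p ^ (e + #|G|))%N; have n_gt0: 0 < n by rewrite expn_gt0 prime_gt0.
have leGn: #|G| <= n.-1.+1.
  rewrite prednK //; apply: leq_trans (ltnW (ltn_expl #|G| p_gt1)) _.
  by rewrite leq_exp2l ?leq_addl.
have phin x: in_core B phi x -> iter n.-1.+1 phi x = x.
  move=> Hx; rewrite prednK // /n expnD mulnC.
  by elim: (p ^ #|G|)%N => // i IHi; rewrite mulSn iterD IHi phie.
have [P [f [t [rep f_inj pP]]]] := hnn_rep_faithful leGn phin.
have {}pP: p.-group [set: P].
  by apply: pP => //; rewrite prednK // pnatX pnat_id.
have [g0 [l [Gg0 Gl red eqw]]] := reduced_form wf.
have [l0 | l1] := eqVneq l [::].
  exists P, (word_val f t); split=> //; first exact: word_val_hom.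
  rewrite (proj2 (word_val_hom rep) _ _ eqw) word_val_nf // l0 /nf_val.
  rewrite big_nil mulg1; apply/eqP=> fg1; case: ntw.
  apply: hnn_eq_trans eqw _; rewrite l0 (f_inj _ Gg0 fg1).
  exact: hnn_eq_step (hnn_one _ _ _ [::] [::]).
have [Q [f' [t' [pi [r [pQ rep' _ rG [r0 r1]]]]]]] :=
  reduced_nf_val p_pr pP rep f_inj Gg0 Gl red.
exists Q, (word_val f' t'); split=> //; first exact: word_val_hom.
rewrite (proj2 (word_val_hom rep') _ _ eqw) word_val_nf //; apply/eqP=> val1.
have l_gt0: 0 < size l by case: (l) l1.
(* If the word had value 1, [r] would take the same value at it as at the prefix [f' g0], by
   invariance under [G]; but these values are 1 and 0. *)
have:= r0 0 l_gt0; rewrite take0 /nf_val big_nil mulg1 -[f' g0]mul1g rG //.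
by rewrite -val1 r1 => /eqP; rewrite oner_eq0.
Qed.

(** * The order of [phi] on the core *)

Lemma hnn_hom_iter (P : finGroupType) (h : hnn_word gT -> P) x i :
    hnn_hom G A phi h -> in_core B phi x ->
  h [:: inl (iter i phi x)] = h [:: inl x] ^ (h [:: inr true] ^+ i).
Proof.
move=> [hM hE] Hx; have h0: h [::] = 1.
  by apply: (mulgI (h [::])); rewrite -hM mulg1.
have hV: h [:: inr false] = (h [:: inr true])^-1.
  apply: (mulgI (h [:: inr true])); rewrite mulgV -hM -h0; apply: hE.
  exact: hnn_eq_step (hnn_tinv _ _ _ [::] [::] true).
elim: i => [|i IHi]; first by rewrite conjg1.
rewrite expgSr conjgM -IHi /= /conjg -hV -!hM; apply/esym/hE/hnn_eq_step.
exact: (hnn_conj _ _ [::] [::] (in_core_dom (in_core_iter _ Hx))).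
Qed.

Lemma core_period_exists :
  exists2 n, 0 < n & forall x, in_core B phi x -> iter n phi x = x.
Proof.
pose F k : {ffun gT -> gT} := [ffun x => iter k phi x].
have /injectivePn[i [j ne_ij eqF]]:
    ~~ injectiveb (fun i : 'I_(#|{: {ffun gT -> gT}}|.+1) => F i).
  by apply/negP=> /injectiveP/leq_card; rewrite card_ord ltnn.
wlog lt_ij: i j ne_ij eqF / i < j.
  move=> IH; case: (ltngtP i j) => [|/IH|eq_ij]; first exact: IH.
    by apply; rewrite // eq_sym.
  by rewrite (val_inj eq_ij) eqxx in ne_ij.
exists (j - i)%N => [|x Hx]; first by rewrite subn_gt0.
have iter_inj k y z: in_core B phi y -> in_core B phi z ->
    iter k phi y = iter k phi z -> y = z.
  move=> Hy Hz; elim: k => //= k IHk /(injmP injphi) eqk.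
  by apply: IHk; apply: eqk; apply/in_core_dom/in_core_iter.
apply: (iter_inj i) => //; first exact: in_core_iter.
by rewrite -iterD subnKC ?(ltnW lt_ij) //; move/ffunP/(_ x): eqF; rewrite !ffunE.
Qed.

Lemma core_aut_order_exists : exists n, core_aut_order B phi n.
Proof.
(* Replacing the core by the stable [L_k] makes the property decidable, so a least period can be
   taken. *)
pose per n := (0 < n) && [forall x in image_chain #|G|, iter n phi x == x].
have perP n: reflect (0 < n /\ forall x, in_core B phi x -> iter n phi x = x)
    (per n).
  apply: (iffP andP) => -[n_gt0 H]; split=> //.
    by move=> x /(in_coreP _ (leqnn _)) Lx; apply/eqP/(forall_inP H).
  by apply/forall_inP=> x /(in_coreP _ (leqnn _)) /H/eqP.
have ex: exists n, per n.
  by have [n n_gt0 Hn] := core_period_exists; exists n; apply/perP.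
have [n /perP[n_gt0 Hn] min_n] := ex_minnP ex.
by exists n; split=> // m m_gt0 Hm; apply/min_n/perP.
Qed.

Lemma core_order_pnat p n :
    hnn_residually_p p G A phi -> core_aut_order B phi n ->
  exists e, n = (p ^ e)%N.
Proof.
move=> res [n_gt0 phin min_n]; exists (logn p n); rewrite -p_part.
apply/eqP; rewrite eqn_leq andbC dvdn_leq ?dvdn_part //=.
apply: min_n => [|x Hx]; first exact: part_gt0.
have phinM k y: in_core B phi y -> iter (k * n) phi y = y.
  by move=> Hy; elim: k => // k IHk; rewrite mulSn iterD IHk phin.
apply/eqP/idPn=> ntx; set q := (n`_p)%N in ntx.
have coreG y: in_core B phi y -> y \in G.
  by move/in_core_dom; apply: (subsetP sAG).
have Gx := coreG x Hx; have Gqx := coreG _ (in_core_iter q Hx).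
pose y := iter q phi x * x^-1; have Gy: y \in G by rewrite groupM ?groupV.
(* A period that is at least [#|G|], used to see that [y] is nontrivial in [G^*]. *)
pose m := (#|G| * n)%N; have m_gt0: 0 < m by rewrite muln_gt0 cardG_gt0.
have [||P [h [pP hom]]] := res [:: inl y].
- by move=> g; rewrite inE => /eqP[->].
- have [||P [f [t [rep f_inj _]]]] := @hnn_rep_faithful m.-1.
  + by rewrite prednK // leq_pmulr.
  + by move=> z Hz; rewrite prednK // phinM.
  move/(proj2 (word_val_hom rep)); rewrite /word_val big_seq1 big_nil /= Gy.
  move/(f_inj _ Gy)/eqP; rewrite -eq_mulgV1; exact/negP.
case/eqP; have [hM hE] := hom.
have h_mul g k: g \in G -> k \in G -> h [:: inl (g * k)] = h [:: inl g] * h [:: inl k].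
  move=> Gg Gk; rewrite -hM; apply/esym/hE.
  exact: hnn_eq_step (hnn_mul _ _ [::] [::] Gg Gk).
suffices hq: h [:: inl (iter q phi x)] = h [:: inl x].
  rewrite h_mul ?groupV // hq -h_mul ?groupV // mulgV.
  rewrite (hE _ [::]); last exact: hnn_eq_step (hnn_one _ _ _ [::] [::]).
  by apply: (mulgI (h [::])); rewrite -hM mulg1.
have hP k z: in_core B phi z -> h [:: inl (iter (#|P| * k) phi z)] = h [:: inl z].
  move=> Hz; rewrite (hnn_hom_iter _ hom Hz) expgM -cardsT.
  by rewrite expg_cardG ?inE // expg1n conjg1.
pose d := gcdn n #|P|.
(* The exponents [i] such that [h] does not separate [phi^i] from the identity
   include [n] and [#|P|], hence their gcd. *)
have hd z: in_core B phi z -> h [:: inl (iter d phi z)] = h [:: inl z].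
  move=> Hz; rewrite /d; case: (egcdnP #|P| n_gt0) => a b def_d _.
  rewrite -[in RHS](phinM a z Hz) def_d iterD mulnC hP //.
  exact: in_core_iter.
(* As a divisor of [#|P|], [d] is a power of [p], and it divides [n]. *)
have dv_dq: d %| q.
  rewrite /q -(@part_pnat_id p d) ?partn_dvd ?dvdn_gcdl //.
  by apply: pnat_dvd (dvdn_gcdr n _) _; rewrite -cardsT.
rewrite -(divnK dv_dq); elim: (q %/ d)%N => // k IHk.
by rewrite mulSn iterD hd //; apply: in_core_iter.
Qed.

End HNN.

Theorem theorem5p4 (p : nat) (gT : finGroupType) (G A B : {group gT})
  (phi : {morphism A >-> gT}) :
  prime p -> (p.-group G)%g -> abelian G ->
  A \subset G -> B \subset G -> isom A B phi ->
  (hnn_residually_p p G A phi <->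
   exists n, core_aut_order B phi n /\ exists e, n = (p ^ e)%N).
Proof.
move=> p_pr pG abG sAG sBG isoAB.
have cardG: #|G| = #|G|.-1.+1 by rewrite prednK ?cardG_gt0.
split=> [res | [n [[n_gt0 phin min_n] [e def_n]]]].
  have [n ord_n] := core_aut_order_exists sAG sBG isoAB; exists n; split=> //.
  exact: (core_order_pnat abG sAG sBG isoAB cardG res ord_n).
by apply: (residually_p_of_period abG sAG sBG isoAB cardG (e := e)); rewrite // -def_n.
Qed.
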